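(* Consider the one-dimensional system of two bouncing balls $P_1$ (upper) and $P_2$ (lower) in an external gravitational field with acceleration $g>0$ above a plate oscillating according to $z=f(t)$. If the masses of both balls are equal and if $f\in\mathcal{C}$, then there exist unbounded motions of both balls of each of the following two types: (a) motions such that $\lim_{i\to\infty}|v^{(1)}_i|=\lim_{i\to\infty}|v^{(2)}_i|=\infty$; (b) motions such that $\limsup_{i\to\infty}|v^{(1)}_i|=\limsup_{i\to\infty}|v^{(2)}_i|=\infty$ and $\max\left(\liminf_{i\to\infty}|v^{(1)}_i|,\ \liminf_{i\to\infty}|v^{(2)}_i|\right)<\infty$.
   Context: One-dimensional system of two bouncing balls: two elastic point particles $P_1,P_2$ move on a vertical line (coordinate $z$) in a gravitational field with constant acceleration $g>0$ (so $\ddot z=-g$ for each ball between collisions), above an infinitely heavy horizontal plate which oscillates according to the law $z=f(t)$, where $f$ is a smooth function of period $T>0$. The balls collide elastically with each other and with the plate. At a collision of a ball with the plate at time $s$, its velocity $v^-$ becomes $v^+=-v^-+2\dot f(s)$. When the balls have equal (positive) masses, at a collision between them they exchange velocities. $P_2$ is the lower ball and $P_1$ is the upper ball. Class $\mathcal{C}$: $\mathcal{C}:=\{f: f \text{ is periodic with period } T \text{ and there exists } t_0 \text{ with } \dot f(t_0)=KTg/2 \text{ for some positive integer } K\}$. Notation: $v^{(2)}_i$ is the velocity of the ball $P_2$ at the moment just after the $i$th collision of $P_2$ with the plate, and $v^{(1)}_i$ is the velocity of the ball $P_1$ at the moment just after the $i$th collision of $P_1$ with $P_2$. *)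

(* Defs.v *)
(* Stdlib reals with Coquelicot. *)
From Stdlib Require Import Reals Lra.
From Coquelicot Require Import Coquelicot.
Open Scope R_scope.

Definition smooth (f : R -> R) : Prop := forall n t, ex_derive_n f n t.

Definition periodic (T : R) (f : R -> R) : Prop := forall t, f (t + T) = f t.

Definition class_C (g T : R) (f : R -> R) : Prop :=
  periodic T f /\
  exists (t0 : R) (K : nat), (0 < K)%nat /\ Derive f t0 = INR K * T * g / 2.

Definition velocity_before (z : R -> R) (t v : R) : Prop :=
  filterlim (fun h => (z (t + h) - z t) / h) (at_left 0) (locally v).

Definition velocity_after (z : R -> R) (t v : R) : Prop :=
  filterlim (fun h => (z (t + h) - z t) / h) (at_right 0) (locally v).

(* Differentiability is stated separately because [is_derive_n z 2] only
   constrains the total function [Derive z]. *)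
Definition free_flight_at (g : R) (z : R -> R) (t : R) : Prop :=
  ex_derive z t /\ is_derive_n z 2 t (- g).

(* [v1], [v2] are the velocities before and [w1], [w2] those after a collision
   of a ball of mass [m1] with a ball of mass [m2] lying below it: momentum and
   kinetic energy are conserved, and the balls do not pass through each other. *)
Definition elastic_collision (m1 m2 v1 v2 w1 w2 : R) : Prop :=
  m1 * w1 + m2 * w2 = m1 * v1 + m2 * v2 /\
  m1 * w1 ^ 2 / 2 + m2 * w2 ^ 2 / 2 = m1 * v1 ^ 2 / 2 + m2 * v2 ^ 2 / 2 /\
  w2 <= w1.

(* Sanity check: balls of equal masses exchange their velocities. *)
Lemma elastic_collision_equal_masses (m v1 v2 w1 w2 : R) :
  0 < m -> v1 <= v2 ->
  elastic_collision m m v1 v2 w1 w2 <-> w1 = v2 /\ w2 = v1.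
Proof.
intros Hm Hv; split.
- intros [Hp [He Hw]].
  assert (Es : w1 + w2 = v1 + v2) by (apply (Rmult_eq_reg_l m); lra).
  assert (Eq : w1 ^ 2 + w2 ^ 2 = v1 ^ 2 + v2 ^ 2)
    by (apply (Rmult_eq_reg_l m); lra).
  assert (Ed : (w1 - v1) * (w1 - v2) = 0).
  { replace w2 with (v1 + v2 - w1) in Eq by lra. lra. }
  destruct (Rmult_integral _ _ Ed); split; lra.
- intros [-> ->]; unfold elastic_collision; repeat split; lra.
Qed.

(* [z1] (upper ball P1) and [z2] (lower ball P2) are positions on the time
   interval [0, +oo); their values at negative times are irrelevant.  Contacts
   at time 0, if any, belong to the initial condition and are not collisions.
   At a simultaneous contact of both balls and the plate the collision laws do
   not determine the motion, so such contacts are excluded. *)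
Record two_ball_motion (g m1 m2 : R) (f z1 z2 : R -> R) : Prop := {
  motion_continuous1 : continuous_on (fun t => 0 <= t) z1;
  motion_continuous2 : continuous_on (fun t => 0 <= t) z2;
  motion_ordered : forall t, 0 <= t -> f t <= z2 t <= z1 t;
  motion_no_triple_collision : forall t, 0 < t -> f t < z1 t;
  motion_free1 : forall t, 0 < t -> z2 t < z1 t -> free_flight_at g z1 t;
  motion_free2 : forall t, 0 < t -> f t < z2 t < z1 t -> free_flight_at g z2 t;
  motion_plate_collision : forall s, 0 < s -> z2 s = f s ->
    exists v : R, velocity_before z2 s v /\
                  velocity_after z2 s (- v + 2 * Derive f s);
  motion_ball_collision : forall s, 0 < s -> z1 s = z2 s ->
    exists v1 v2 w1 w2 : R,
      velocity_before z1 s v1 /\ velocity_before z2 s v2 /\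
      velocity_after z1 s w1 /\ velocity_after z2 s w2 /\
      elastic_collision m1 m2 v1 v2 w1 w2
}.

(* [s] lists, in chronological order, all the times satisfying [P].  For the
   contact times of a motion this forces [s] to tend to +oo: a finite limit would,
   by continuity, be a contact time missing from the list. *)
Definition chronological_enumeration (P : R -> Prop) (s : nat -> R) : Prop :=
  (forall i, s i < s (S i)) /\ (forall t, P t <-> exists i, s i = t).

(* [V2 i] is the velocity of P2 just after its [i]-th collision with the plate;
   in particular there are infinitely many such collisions. *)
Definition plate_velocities (f z2 : R -> R) (V2 : nat -> R) : Prop :=
  exists s : nat -> R,
    chronological_enumeration (fun t => 0 < t /\ z2 t = f t) s /\
    forall i, velocity_after z2 (s i) (V2 i).

(* [V1 i] is the velocity of P1 just after its [i]-th collision with P2. *)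
Definition ball_velocities (z1 z2 : R -> R) (V1 : nat -> R) : Prop :=
  exists s : nat -> R,
    chronological_enumeration (fun t => 0 < t /\ z1 t = z2 t) s /\
    forall i, velocity_after z1 (s i) (V1 i).

Definition Rbar_max (x y : Rbar) : Rbar := if Rbar_le_dec x y then y else x.

(* Main.v *)
Require Import Defs.
From Stdlib Require Import ZArith Reals Lra Lia ClassicalEpsilon.
From Coquelicot Require Import Coquelicot.
Open Scope R_scope.

(** Balls of equal masses exchange their velocities when they meet, so up to
    their names they pass through each other.  A motion of the system is thus the
    superposition of two balls which meet only the plate: the upper ball follows
    the maximum of the two trajectories and the lower ball their minimum
    ([superposed_motion]).  This needs the two balls never to be on the plate at
    the same time.  For the collision times to form a sequence the balls must also
    never touch with equal velocities, and for this sequence to be infinite both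
    must keep returning to the plate: between their visits to the plate they
    change order, hence cross ([generic_pair], [generic_pair_motion]).

    A positive multiple [K T] of the period is again a period, so the plate has,
    at some time [c], the velocity [P g / 2] where [P] is a period.  A ball which
    leaves the plate at time [c] with velocity [n P g / 2] comes back after the
    time [n P], at the same phase of the plate, and leaves with velocity
    [(n + 2) P g / 2]: it accelerates for ever.  The parabolas start and end at
    the same height [f c], and they avoid the plate in between as soon as their
    duration is large compared with the Lipschitz constant of [f]
    ([arc_above_plate], [resonant_ball_exists]).

    For motions whose velocities all tend to infinity, take two such balls, with
    bounces at the times [c + P j (j + 1)] and [c + P j ^ 2].  Velocities after
    plate collisions tend to infinity, but a crossing near the tops of both
    parabolas would be slow.  The two sequences are chosen so that each ball
    bounces about when the other is at its top; then crossings take place about a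
    quarter of a flight after or before a bounce, where the ball going up still has
    about half of the velocity with which it left the plate
    ([resonant_crossing_fast]).

    For motions with oscillating velocities, superpose one accelerating ball and a
    ball which bounces periodically at a time when the plate is at rest.  Just
    after a bounce of the accelerating ball it crosses the low one upwards with a
    large velocity, and just before its next bounce it crosses it downwards, which
    sends up the slow ball ([fast_ball_contact], [slow_ball_contact]).  Likewise
    the plate is hit infinitely often by either ball.

    Contacts with equal velocities are excluded by conservation of energy: the two
    flights would have the same peak height.  In the first case the durations of
    the flights are even multiples of [P] for one ball and odd ones for the other,
    and in the second case the accelerating ball peaks above the low one. *)

(** * One-sided and punctured neighbourhoods *)

Lemma at_left_iff_ball (t : R) (P : R -> Prop) :
  at_left t P <-> exists d : posreal, forall u, t - d < u < t -> P u.
Proof.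
split.
- intros [d Hd]; exists d; intros u Hu; apply Hd; [|lra].
  change (Rabs (u - t) < d); apply Rabs_def1; lra.
- intros [d Hd]; exists d; intros u Hu Hut; apply Hd.
  change (Rabs (u - t) < d) in Hu; apply Rabs_def2 in Hu; lra.
Qed.

Lemma at_right_iff_ball (t : R) (P : R -> Prop) :
  at_right t P <-> exists d : posreal, forall u, t < u < t + d -> P u.
Proof.
split.
- intros [d Hd]; exists d; intros u Hu; apply Hd; [|lra].
  change (Rabs (u - t) < d); apply Rabs_def1; lra.
- intros [d Hd]; exists d; intros u Hu Hut; apply Hd.
  change (Rabs (u - t) < d) in Hu; apply Rabs_def2 in Hu; lra.
Qed.

Lemma at_left_of_locally (t : R) (P : R -> Prop) : locally t P -> at_left t P.
Proof. intros [d Hd]; exists d; auto. Qed.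

Lemma at_right_of_locally (t : R) (P : R -> Prop) : locally t P -> at_right t P.
Proof. intros [d Hd]; exists d; auto. Qed.

Lemma punctured_of_sides (t : R) (P : R -> Prop) :
  at_left t P -> at_right t P -> locally' t P.
Proof.
unfold at_left, at_right, locally', within; intros Hl Hr.
generalize (filter_and _ _ Hl Hr); apply filter_imp; intros u [H1 H2] Hu; destruct (Rdichotomy u t Hu); auto.
Qed.

Lemma locally_of_punctured (t : R) (P : R -> Prop) :
  P t -> locally' t P -> locally t P.
Proof.
unfold locally', within; intros H0; apply filter_imp; intros u Hu.
destruct (Req_dec u t) as [->|Hne]; auto.
Qed.

(** * The local law of a single ball *)

Definition parabola (g : R) (z : R -> R) (t v u : R) : R :=
  z t + v * (u - t) - g / 2 * (u - t) ^ 2.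

(** Coincidence with a parabola on a whole one-sided neighbourhood gives the
    one-sided velocity and, when both sides carry the same velocity, the law of
    free flight. *)
Definition launches (g : R) (z : R -> R) (t v : R) : Prop :=
  at_right t (fun u => z u = parabola g z t v u).

Definition lands (g : R) (z : R -> R) (t v : R) : Prop :=
  at_left t (fun u => z u = parabola g z t v u).

(** The law of a ball which meets only the plate, with velocities [v] before and
    [w] after [t].  It is local, so that the upper and the lower ball inherit it
    away from the crossings. *)
Definition bouncing_at (g : R) (f z : R -> R) (t v w : R) : Prop :=
  lands g z t v /\ launches g z t w /\ locally' t (fun u => f u < z u) /\
  ((f t < z t /\ v = w) \/ (z t = f t /\ w = - v + 2 * Derive f t)).

Definition bouncing (g : R) (f z : R -> R) : Prop :=
  forall t, 0 <= t -> exists v w, bouncing_at g f z t v w.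

Lemma bouncing_at_ext_loc (g : R) (f z y : R -> R) (t v w : R) :
  locally t (fun u => y u = z u) ->
  bouncing_at g f y t v w -> bouncing_at g f z t v w.
Proof.
unfold bouncing_at, lands, launches; intros Hyz [Hl [Hr [Ha Hd]]].
assert (Ht := locally_singleton _ _ Hyz); simpl in Ht.
split; [|split; [|split]].
- generalize (filter_and _ _ (at_left_of_locally _ _ Hyz) Hl); apply filter_imp.
  intros u [H1 H2].
  unfold parabola in *; now rewrite <- Ht, <- H1.
- generalize (filter_and _ _ (at_right_of_locally _ _ Hyz) Hr); apply filter_imp.
  intros u [H1 H2].
  unfold parabola in *; now rewrite <- Ht, <- H1.
- unfold locally', within in *.
  generalize (filter_and _ _ Hyz Ha); apply filter_imp.
  intros u [H1 H2] Hu; rewrite <- H1; auto.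
- now rewrite <- Ht.
Qed.

Lemma continuous_parabola (g : R) (z : R -> R) (t v : R) :
  filterlim (parabola g z t v) (locally t) (locally (z t)).
Proof.
replace (z t) with (parabola g z t v t) by (unfold parabola; ring).
apply (ex_derive_continuous (K := R_AbsRing) (V := R_NormedModule)).
unfold parabola; auto_derive; auto.
Qed.

Lemma bouncing_at_continuous (g : R) (f z : R -> R) (t v w : R) :
  bouncing_at g f z t v w -> filterlim z (locally t) (locally (z t)).
Proof.
unfold bouncing_at, lands, launches; intros [Hl [Hr _]] P HP.
assert (Hcl := continuous_parabola g z t v P HP).
assert (Hcr := continuous_parabola g z t w P HP).
apply locally_of_punctured; [now apply locally_singleton in HP|].
apply punctured_of_sides.
- generalize (filter_and _ _ Hl (at_left_of_locally _ _ Hcl)); apply filter_imp.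
  intros u [H1 H2]; rewrite H1; exact H2.
- generalize (filter_and _ _ Hr (at_right_of_locally _ _ Hcr)); apply filter_imp.
  intros u [H1 H2]; rewrite H1; exact H2.
Qed.

Lemma linear_near_0 (v c : R) :
  filterlim (fun h => v - c * h) (locally 0) (locally v).
Proof.
assert (H : continuous (fun h => v - c * h) 0).
{ apply (ex_derive_continuous (K := R_AbsRing) (V := R_NormedModule)).
  auto_derive; auto. }
unfold continuous in H; now rewrite Rmult_0_r, Rminus_0_r in H.
Qed.

Lemma launches_velocity (g : R) (z : R -> R) (t v : R) :
  launches g z t v -> velocity_after z t v.
Proof.
intros H; apply at_right_iff_ball in H; destruct H as [d Hd].
apply filterlim_ext_loc with (f := fun h => v - g / 2 * h).
- apply at_right_iff_ball; exists d; intros h Hh.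
  rewrite (Hd (t + h)); [|lra]; unfold parabola; field; lra.
- eapply filterlim_filter_le_1; [apply (filter_le_within (F := locally 0))|].
  apply linear_near_0.
Qed.

Lemma lands_velocity (g : R) (z : R -> R) (t v : R) :
  lands g z t v -> velocity_before z t v.
Proof.
intros H; apply at_left_iff_ball in H; destruct H as [d Hd].
apply filterlim_ext_loc with (f := fun h => v - g / 2 * h).
- apply at_left_iff_ball; exists d; intros h Hh.
  rewrite (Hd (t + h)); [|lra]; unfold parabola; field; lra.
- eapply filterlim_filter_le_1; [apply (filter_le_within (F := locally 0))|].
  apply linear_near_0.
Qed.

Lemma velocity_after_unique (z : R -> R) (t v w : R) :
  velocity_after z t v -> velocity_after z t w -> v = w.
Proof.
apply (filterlim_locally_unique (V := R_NormedModule) (F := at_right 0)).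
Qed.

Lemma bouncing_at_free_flight (g : R) (f z : R -> R) (t v w : R) :
  bouncing_at g f z t v w -> f t < z t -> free_flight_at g z t.
Proof.
unfold bouncing_at, lands, launches; intros [Hl [Hr [_ Hd]]] Hf.
assert (v = w) as -> by (destruct Hd as [[_ Hd]|[Hd _]]; [exact Hd|lra]).
assert (Hloc : locally t (fun u => parabola g z t w u = z u)).
{ apply locally_of_punctured; [unfold parabola; ring|].
  apply punctured_of_sides; [revert Hl|revert Hr]; apply filter_imp;
    intros u Hu; now symmetry. }
split.
- apply ex_derive_ext_loc with (1 := Hloc).
  unfold parabola; auto_derive; auto.
- apply is_derive_n_ext_loc with (1 := Hloc); simpl.
  apply is_derive_ext with (f := fun u => w - g * (u - t)).
  + intros u; symmetry; apply is_derive_unique.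
    unfold parabola; auto_derive; [auto|field].
  + auto_derive; [auto|ring].
Qed.

(** * Superposition of two balls *)

Definition upper (x y : R -> R) (t : R) : R := Rmax (x t) (y t).
Definition lower (x y : R -> R) (t : R) : R := Rmin (x t) (y t).

Lemma locally_lt_of_bouncing (g : R) (f x y : R -> R) (t : R) :
  bouncing g f x -> bouncing g f y -> 0 <= t -> y t < x t ->
  locally t (fun u => y u < x u).
Proof.
intros Hx Hy Ht Hlt.
destruct (Hx t Ht) as [vx [wx Bx]]; destruct (Hy t Ht) as [vy [wy By]].
apply bouncing_at_continuous in Bx; apply bouncing_at_continuous in By.
pose (m := (x t + y t) / 2).
assert (H1 : locally t (fun u => m < x u)).
{ apply (Bx (fun z => m < z)), (open_gt m); unfold m; lra. }
assert (H2 : locally t (fun u => y u < m)).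
{ apply (By (fun z => z < m)), (open_lt m); unfold m; lra. }
generalize (filter_and _ _ H1 H2); apply filter_imp; intros u Hu; lra.
Qed.

Lemma upper_lower_separated (x y : R -> R) (t : R) :
  locally t (fun u => y u < x u) ->
  (locally t (fun u => x u = upper x y u) /\ locally t (fun u => y u = lower x y u)) /\
  (locally t (fun u => x u = upper y x u) /\ locally t (fun u => y u = lower y x u)).
Proof.
intros H; repeat split; revert H; apply filter_imp; intros u Hu; symmetry;
  unfold upper, lower; [apply Rmax_left|apply Rmin_right|apply Rmax_right|apply Rmin_left]; lra.
Qed.

(** Free-fall parabolas through a common point differ by a linear function, so
    right of the crossing the faster of the two balls is above, and left of it
    the slower one is. *)
Lemma upper_lower_crossing (g : R) (f x y : R -> R) (t v w : R) :
  bouncing_at g f x t v v -> bouncing_at g f y t w w -> x t = y t ->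
  lands g (upper x y) t (Rmin v w) /\ lands g (lower x y) t (Rmax v w) /\
  launches g (upper x y) t (Rmax v w) /\ launches g (lower x y) t (Rmin v w).
Proof.
intros [Hlx [Hrx _]] [Hly [Hry _]] Hxy.
unfold lands, launches, at_left, at_right, within in *.
assert (Hl := filter_and _ _ Hlx Hly); assert (Hr := filter_and _ _ Hrx Hry).
repeat split; [revert Hl|revert Hl|revert Hr|revert Hr]; apply filter_imp;
  intros u Hu Hut; destruct Hu as [H1 H2]; specialize (H1 Hut); specialize (H2 Hut); unfold upper, lower, parabola in *;
  rewrite H1, H2, <- Hxy; unfold Rmin, Rmax;
  repeat destruct Rle_dec; nra.
Qed.

(** At a crossing the two trajectories go through each other, which for the upper
    and the lower ball is an exchange of velocities; everywhere else each of these
    two coincides locally with one of the trajectories. *)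
Lemma superposed_motion (g m : R) (f x y : R -> R) :
  0 < m -> bouncing g f x -> bouncing g f y ->
  (forall t, 0 <= t -> x t = f t -> y t <> f t) ->
  two_ball_motion g m m f (upper x y) (lower x y).
Proof.
intros Hm Bx By Hno.
assert (Hab : forall z, bouncing g f z -> forall t, 0 <= t -> f t <= z t).
{ intros z Bz t Ht; destruct (Bz t Ht) as [v [w [_ [_ [_ H]]]]]; lra. }
assert (Hcross : forall t, 0 <= t -> x t = y t ->
  exists v w, bouncing_at g f x t v v /\ bouncing_at g f y t w w).
{ intros t Ht E; destruct (Bx t Ht) as [v [v' Hv]]; destruct (By t Ht) as [w [w' Hw]].
  exists v, w; split.
  - destruct (proj2 (proj2 (proj2 Hv))) as [[_ ->]|[H _]]; [exact Hv|].
    destruct (Hno t Ht H); congruence.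
  - destruct (proj2 (proj2 (proj2 Hw))) as [[_ ->]|[H _]]; [exact Hw|].
    destruct (Hno t Ht); congruence. }
(* Away from a crossing, the upper and the lower trajectory are locally those of
   single balls. *)
assert (Hsep : forall t, 0 <= t -> x t <> y t ->
  (exists v w, bouncing_at g f (upper x y) t v w) /\
  (exists v w, bouncing_at g f (lower x y) t v w)).
{ intros t Ht Hne.
  destruct (Bx t Ht) as [v [v' Hv]]; destruct (By t Ht) as [w [w' Hw]].
  destruct (Rdichotomy _ _ Hne) as [Hlt|Hlt].
  - apply (locally_lt_of_bouncing g f) in Hlt; auto.
    destruct (upper_lower_separated _ _ _ Hlt) as [_ [E1 E2]].
    split; [exists w, w'|exists v, v']; eapply bouncing_at_ext_loc; eauto.
  - apply (locally_lt_of_bouncing g f) in Hlt; auto.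
    destruct (upper_lower_separated _ _ _ Hlt) as [[E1 E2] _].
    split; [exists v, v'|exists w, w']; eapply bouncing_at_ext_loc; eauto. }
assert (Hneq : forall t, lower x y t <> upper x y t -> x t <> y t).
{ intros t H E; apply H; unfold lower, upper; rewrite E.
  now rewrite Rmin_left, Rmax_left by lra. }
assert (Heq : forall t, upper x y t = lower x y t -> x t = y t).
{ intros t; unfold upper, lower, Rmax, Rmin; destruct Rle_dec; lra. }
assert (Hcontu : forall t, 0 <= t ->
  filterlim (upper x y) (locally t) (locally (upper x y t)) /\
  filterlim (lower x y) (locally t) (locally (lower x y t))).
{ intros t Ht.
  destruct (Bx t Ht) as [v [v' Hv]]; destruct (By t Ht) as [w [w' Hw]].
  apply bouncing_at_continuous, continuity_pt_filterlim in Hv.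
  apply bouncing_at_continuous, continuity_pt_filterlim in Hw.
  split; apply continuity_pt_filterlim.
  - apply continuity_pt_ext with (f := fun u => (x u + y u + Rabs (x u - y u)) / 2).
    + intros u; unfold upper, Rmax, Rabs; destruct Rle_dec, Rcase_abs; lra.
    + apply continuity_pt_mult; [|apply continuity_pt_const; red; auto].
      apply continuity_pt_plus; [now apply continuity_pt_plus|].
      apply (continuity_pt_comp (fun u => x u - y u) Rabs).
      * now apply continuity_pt_minus.
      * apply Rcontinuity_abs.
  - apply continuity_pt_ext with (f := fun u => (x u + y u - Rabs (x u - y u)) / 2).
    + intros u; unfold lower, Rmin, Rabs; destruct Rle_dec, Rcase_abs; lra.
    + apply continuity_pt_mult; [|apply continuity_pt_const; red; auto].
      apply continuity_pt_minus; [now apply continuity_pt_plus|].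
      apply (continuity_pt_comp (fun u => x u - y u) Rabs).
      * now apply continuity_pt_minus.
      * apply Rcontinuity_abs. }
split.
- intros t Ht; eapply filterlim_filter_le_1; [apply filter_le_within|].
  apply Hcontu, Ht.
- intros t Ht; eapply filterlim_filter_le_1; [apply filter_le_within|].
  apply Hcontu, Ht.
- intros t Ht; generalize (Hab x Bx t Ht) (Hab y By t Ht).
  unfold upper, lower, Rmax, Rmin; destruct Rle_dec; lra.
- intros t Ht; generalize (Hab x Bx t (Rlt_le _ _ Ht)) (Hab y By t (Rlt_le _ _ Ht)).
  generalize (Hno t (Rlt_le _ _ Ht)).
  unfold upper, Rmax; destruct Rle_dec; intros H H1 H2; apply Rnot_le_lt; intros H3;
    apply H; lra.
- intros t Ht Hlt; destruct (Hsep t) as [[v [w B]] _]; [lra|apply Hneq; lra|].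
  apply bouncing_at_free_flight with (1 := B).
  generalize (Hab x Bx t (Rlt_le _ _ Ht)) (Hab y By t (Rlt_le _ _ Ht)).
  revert Hlt; unfold upper, lower, Rmax, Rmin; destruct Rle_dec; lra.
- intros t Ht Hlt; destruct (Hsep t) as [_ [v [w B]]]; [lra|apply Hneq; lra|].
  apply bouncing_at_free_flight with (1 := B); lra.
- intros s Hs Hc.
  destruct (Req_dec (x s) (y s)) as [E|Hne].
  + exfalso; apply (Hno s); unfold lower in Hc; rewrite E in *;
      rewrite Rmin_left in Hc; lra.
  + destruct (Hsep s) as [_ [v [w B]]]; [lra|exact Hne|].
    exists v; destruct B as [Hl [Hr [_ [[H _]|[_ ->]]]]]; [lra|].
    split; [now apply lands_velocity with g|now apply launches_velocity with g].
- intros s Hs Hc; apply Heq in Hc.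
  destruct (Hcross s) as [v [w [Hv Hw]]]; [lra|exact Hc|].
  destruct (upper_lower_crossing _ _ _ _ _ _ _ Hv Hw Hc) as [H1 [H2 [H3 H4]]].
  exists (Rmin v w), (Rmax v w), (Rmax v w), (Rmin v w).
  split; [now apply lands_velocity with g|].
  split; [now apply lands_velocity with g|].
  split; [now apply launches_velocity with g|].
  split; [now apply launches_velocity with g|].
  apply elastic_collision_equal_masses; [exact Hm| |auto].
  apply Rle_trans with v; [apply Rmin_l|apply Rmax_l].
Qed.

(** * Enumerating event times *)

(** Excluding accumulation at every real, not only at events, makes [P] closed
    as well as discrete: this is what lets the next event be chosen. *)
Definition no_accumulation (P : R -> Prop) : Prop :=
  forall t, locally' t (fun u => ~ P u).

Lemma punctured_radius (t : R) (P : R -> Prop) :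
  locally' t P -> exists d, 0 < d /\ forall u, u <> t -> t - d < u < t + d -> P u.
Proof.
intros [d Hd]; exists d; split; [apply cond_pos|]; intros u Hne Hu; apply Hd; auto.
change (Rabs (u - t) < d); apply Rabs_def1; lra.
Qed.

Lemma next_event (P : R -> Prop) :
  no_accumulation P -> (forall t, exists u, t < u /\ P u) ->
  forall t, exists u, (t < u /\ P u) /\ forall v, t < v -> P v -> u <= v.
Proof.
intros Hd Hinf t.
destruct (completeness (fun u => forall v, t < v -> P v -> u <= v)) as [m [Hub Hlub]].
- destruct (Hinf t) as [b [Hb Pb]]; exists b; intros u Hu; auto.
- exists t; intros v Hv _; lra.
- assert (Htm : t <= m) by (apply Hub; intros v Hv _; lra).
  assert (Hm : forall v, t < v -> P v -> m <= v).
  { intros v Hv Pv; apply Hlub; intros u Hu; auto. }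
  exists m; split; [|exact Hm].
  apply NNPP; intros Hno.
  destruct (punctured_radius _ _ (Hd m)) as [d [Hd0 Hdm]].
  assert (m + d / 2 <= m); [|lra].
  apply Hub; intros v Hv Pv; apply Rnot_lt_le; intros Hlt.
  assert (H := Hm v Hv Pv).
  destruct (Req_dec v m) as [->|Hne]; [tauto|].
  apply (Hdm v Hne); [lra|exact Pv].
Qed.

Lemma event_sequence_unbounded (P : R -> Prop) (s : nat -> R) :
  no_accumulation P -> (forall i, s i < s (S i)) -> (forall i, P (s i)) ->
  forall B, exists i, B < s i.
Proof.
intros Hd Hs HP B; apply NNPP; intros Hno.
destruct (completeness (fun x => exists i, x = s i)) as [m [Hub Hlub]].
- exists B; intros x [i ->]; apply Rnot_lt_le; intros H; apply Hno; eauto.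
- exists (s 0%nat); eauto.
- destruct (punctured_radius _ _ (Hd m)) as [d [Hd0 Hdm]].
  assert (Hi : exists i, m - d < s i).
  { apply NNPP; intros Hni; assert (m <= m - d); [|lra].
    apply Hlub; intros x [i ->]; apply Rnot_lt_le; intros H; apply Hni; eauto. }
  destruct Hi as [i Hi].
  assert (H1 : s (S i) <= m) by (apply Hub; eauto).
  assert (H2 := Hs i).
  apply (Hdm (s i)); [lra|lra|apply HP].
Qed.

Lemma chronological_enumeration_exists (P : R -> Prop) :
  no_accumulation P -> (forall t, P t -> 0 < t) -> (forall t, exists u, t < u /\ P u) ->
  exists s, chronological_enumeration P s.
Proof.
intros Hd Hpos Hinf.
destruct (choice _ (next_event P Hd Hinf)) as [next Hnext].
pose (s := nat_rect (fun _ => R) (next 0) (fun _ u => next u)).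
assert (Hs : forall i, s i < s (S i)) by (intros i; apply Hnext).
assert (HP : forall i, P (s i)) by (intros [|i]; apply Hnext).
exists s; split; [exact Hs|]; intros t; split; [|intros [i <-]; auto].
intros Pt.
(* The first listed event which is not before [t] is the event following one
   before [t], hence it is [t] itself. *)
assert (Hcatch : forall i, t <= s i -> exists j, s j = t).
{ induction i as [|i IH]; intros Hi.
  - exists 0%nat; apply Rle_antisym; [|exact Hi].
    apply (Hnext 0); auto.
  - destruct (Rle_lt_dec t (s i)) as [H|H]; [auto|].
    exists (S i); apply Rle_antisym; [|exact Hi].
    apply (Hnext (s i)); auto. }
destruct (event_sequence_unbounded P s Hd Hs HP t) as [i Hi].
apply (Hcatch i); lra.
Qed.

(** Common form of [ball_velocities] and [plate_velocities]. *)
Definition event_velocities (z : R -> R) (P : R -> Prop) (V : nat -> R) : Prop :=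
  exists s, chronological_enumeration P s /\ forall i, velocity_after z (s i) (V i).

Lemma event_velocities_exist (z : R -> R) (P : R -> Prop) :
  no_accumulation P -> (forall t, P t -> 0 < t) -> (forall t, exists u, t < u /\ P u) ->
  (forall t, P t -> exists v, velocity_after z t v) ->
  exists V, event_velocities z P V.
Proof.
intros Hd Hpos Hinf Hv.
destruct (chronological_enumeration_exists P Hd Hpos Hinf) as [s Hs].
destruct (choice (fun i v => velocity_after z (s i) v)) as [V HV].
- intros i; apply Hv, Hs; eauto.
- exists V, s; auto.
Qed.

Lemma increasing_sequence_lt (s : nat -> R) :
  (forall i, s i < s (S i)) -> forall i j, s i < s j -> (i < j)%nat.
Proof.
intros Hs i j Hij; apply Nat.nle_gt; intros Hle; revert Hij; apply Rle_not_lt.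
induction Hle as [|k _ IH]; [apply Rle_refl|].
apply Rle_trans with (1 := IH), Rlt_le, Hs.
Qed.

Lemma event_velocities_lim_infty (z : R -> R) (P : R -> Prop) (V : nat -> R) :
  no_accumulation P -> event_velocities z P V ->
  (forall M, exists b, forall t v, b < t -> P t -> velocity_after z t v -> M < Rabs v) ->
  is_lim_seq (fun i => Rabs (V i)) p_infty.
Proof.
intros Hd [s [[Hs HP] HV]] Hlim; apply is_lim_seq_spec; intros M.
destruct (Hlim M) as [b Hb].
assert (HPs : forall i, P (s i)) by (intros i; apply HP; eauto).
destruct (event_sequence_unbounded P s Hd Hs HPs b) as [N HN].
exists N; intros n Hn; apply (Hb (s n)); auto.
apply Rlt_le_trans with (1 := HN), Rnot_lt_le; intros H.
apply (increasing_sequence_lt s Hs) in H; lia.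
Qed.

Lemma event_velocities_limsup_infty (z : R -> R) (P : R -> Prop) (V : nat -> R) :
  event_velocities z P V ->
  (forall M b, exists t v, b < t /\ P t /\ velocity_after z t v /\ M < Rabs v) ->
  LimSup_seq (fun i => Rabs (V i)) = p_infty.
Proof.
intros [s [[Hs HP] HV]] H; apply is_LimSup_seq_unique; intros M N.
destruct (H M (s N)) as [t [v [Hb [Pt [Hv HM]]]]].
apply HP in Pt; destruct Pt as [n <-].
exists n; split; [apply Nat.lt_le_incl, (increasing_sequence_lt s Hs), Hb|].
now rewrite (velocity_after_unique _ _ _ _ (HV n) Hv).
Qed.

Lemma event_velocities_liminf_finite (z : R -> R) (P : R -> Prop) (V : nat -> R) (M : R) :
  event_velocities z P V ->
  (forall b, exists t v, b < t /\ P t /\ velocity_after z t v /\ Rabs v <= M) ->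
  Rbar_lt (LimInf_seq (fun i => Rabs (V i))) p_infty.
Proof.
intros [s [[Hs HP] HV]] H.
destruct (ex_LimInf_seq (fun i => Rabs (V i))) as [l Hl].
rewrite (is_LimInf_seq_unique _ _ Hl).
destruct l as [l| |]; simpl; auto.
destruct (Hl M) as [N HN].
destruct (H (s N)) as [t [v [Hb [Pt [Hv HM]]]]].
apply HP in Pt; destruct Pt as [n <-].
apply (increasing_sequence_lt s Hs), Nat.lt_le_incl, HN in Hb.
rewrite (velocity_after_unique _ _ _ _ (HV n) Hv) in Hb; lra.
Qed.

(** * Collisions of two superposed balls *)

Definition plate_contact (f z : R -> R) (t : R) : Prop := 0 < t /\ z t = f t.
Definition ball_contact (x y : R -> R) (t : R) : Prop := 0 < t /\ upper x y t = lower x y t.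

(** What makes the superposition of two balls a motion with infinite sequences of
    collisions.  Transversality is needed because balls that touch in flight with
    equal velocities stay together, and their contacts fill an interval. *)
Record generic_pair (g : R) (f x y : R -> R) : Prop := {
  pair_bouncing1 : bouncing g f x;
  pair_bouncing2 : bouncing g f y;
  pair_no_triple : forall t, 0 <= t -> x t = f t -> y t <> f t;
  pair_transversal : forall t v, 0 <= t -> x t = y t ->
    bouncing_at g f x t v v -> ~ bouncing_at g f y t v v;
  pair_recurrent1 : forall b, exists t, b < t /\ x t = f t;
  pair_recurrent2 : forall b, exists t, b < t /\ y t = f t
}.

Lemma bouncing_above (g : R) (f x : R -> R) (t : R) :
  bouncing g f x -> 0 <= t -> f t <= x t.
Proof. intros B Ht; destruct (B t Ht) as [v [w [_ [_ [_ H]]]]]; lra. Qed.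

Lemma upper_eq_lower (x y : R -> R) (t : R) : upper x y t = lower x y t <-> x t = y t.
Proof. unfold upper, lower, Rmax, Rmin; destruct Rle_dec; split; lra. Qed.

Lemma pair_crossing_velocities (g : R) (f x y : R -> R) (t : R) :
  generic_pair g f x y -> 0 <= t -> x t = y t ->
  f t < x t /\
  exists v w, bouncing_at g f x t v v /\ bouncing_at g f y t w w /\ v <> w.
Proof.
intros [Bx By Hno Htr _ _] Ht E.
destruct (Bx t Ht) as [v [v' Hv]]; destruct (By t Ht) as [w [w' Hw]].
assert (Hf : f t < x t).
{ destruct (bouncing_above _ _ _ _ Bx Ht) as [H|H]; [exact H|].
  destruct (Hno t Ht); congruence. }
split; [exact Hf|exists v, w].
destruct (proj2 (proj2 (proj2 Hv))) as [[_ E1]|[E1 _]]; [subst v'|lra].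
destruct (proj2 (proj2 (proj2 Hw))) as [[_ E2]|[E2 _]]; [subst w'|lra].
repeat split; try apply Hv; try apply Hw.
intros ->; now apply (Htr t w).
Qed.

Lemma locally_negative (t : R) (P : R -> Prop) :
  t < 0 -> locally' t (fun u => ~ (0 < u /\ P u)).
Proof.
intros Ht; unfold locally', within.
assert (H : locally t (fun u => u < 0)) by now apply (open_lt 0).
revert H; apply filter_imp; intros u Hu _ [H _]; lra.
Qed.

Lemma ball_contacts_no_accumulation (g : R) (f x y : R -> R) :
  generic_pair g f x y -> no_accumulation (ball_contact x y).
Proof.
intros Hp t; destruct (Rlt_le_dec t 0) as [Ht|Ht]; [now apply locally_negative|].
destruct (Req_dec (x t) (y t)) as [E|Hne].
- destruct (pair_crossing_velocities _ _ _ _ _ Hp Ht E) as [_ [v [w [[Hlx [Hrx _]] [[Hly [Hry _]] Hvw]]]]].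
  unfold lands, launches in *.
  apply punctured_of_sides;
    [generalize (filter_and _ _ Hlx Hly)|generalize (filter_and _ _ Hrx Hry)];
    unfold at_left, at_right, within; apply filter_imp;
    intros u Hu Hut [_ H]; apply (proj1 (upper_eq_lower _ _ _)) in H;
    destruct (Hu Hut) as [H1 H2]; rewrite H1, H2 in H;
    unfold parabola in H; rewrite E in H;
    apply Hvw, (Rmult_eq_reg_r (u - t)); lra.
- destruct Hp as [Bx By _ _ _ _]; unfold locally', within.
  destruct (Rdichotomy _ _ Hne) as [H|H]; apply (locally_lt_of_bouncing g f) in H; auto;
    revert H; apply filter_imp; intros u Hu _ [_ H]; apply (proj1 (upper_eq_lower _ _ _)) in H; lra.
Qed.

Lemma plate_contacts_no_accumulation (g : R) (f x y : R -> R) :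
  generic_pair g f x y -> no_accumulation (plate_contact f (lower x y)).
Proof.
intros [Bx By _ _ _ _] t; destruct (Rlt_le_dec t 0) as [Ht|Ht]; [now apply locally_negative|].
destruct (Bx t Ht) as [_ [_ [_ [_ [Hx _]]]]]; destruct (By t Ht) as [_ [_ [_ [_ [Hy _]]]]].
generalize (filter_and _ _ Hx Hy); unfold locally', within; apply filter_imp.
intros u Hu Hut [_ H]; destruct (Hu Hut) as [H1 H2].
unfold lower, Rmin in H; destruct Rle_dec; lra.
Qed.

(** A ball standing on the plate is below the other one, so the balls change
    order between a plate contact of the first and one of the second. *)
Lemma crossing_between (g : R) (f x y : R -> R) (a b : R) :
  generic_pair g f x y -> 0 <= a < b ->
  (x a = f a /\ y b = f b) \/ (y a = f a /\ x b = f b) ->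
  exists t, a < t < b /\ x t = y t.
Proof.
intros Hp Hab Hc.
assert (Hcont : forall z w, bouncing g f z -> bouncing g f w ->
  z a < w a -> w b < z b -> exists t, a < t < b /\ z t = w t).
{ intros z w Bz Bw Ha Hb.
  destruct (Ranalysis5.IVT_interv (fun t => z t - w t) a b) as [t [Ht E]]; [|lra|lra|lra|].
  - intros t Ht; apply continuity_pt_minus; apply continuity_pt_filterlim.
    + destruct (Bz t) as [v [v' B]]; [lra|]; eapply bouncing_at_continuous, B.
    + destruct (Bw t) as [v [v' B]]; [lra|]; eapply bouncing_at_continuous, B.
  - exists t; split; [|lra].
    assert (t <> a) by (intros ->; lra); assert (t <> b) by (intros ->; lra); lra. }
destruct Hp as [Bx By Hno _ _ _].
assert (Hxy : forall t, 0 <= t -> x t = f t -> x t < y t).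
{ intros t Ht E; generalize (bouncing_above _ _ _ _ By Ht) (Hno t Ht E); lra. }
assert (Hyx : forall t, 0 <= t -> y t = f t -> y t < x t).
{ intros t Ht E; destruct (bouncing_above _ _ _ _ Bx Ht) as [H|H]; [lra|].
  destruct (Hno t Ht); congruence. }
destruct Hc as [[Ha Hb]|[Ha Hb]].
- apply Hcont; auto; [apply Hxy|apply Hyx]; auto; lra.
- destruct (Hcont y x) as [t [Ht E]]; auto; [apply Hyx|apply Hxy|exists t]; auto; lra.
Qed.

Lemma ball_contacts_unbounded (g : R) (f x y : R -> R) :
  generic_pair g f x y -> forall b, exists t, b < t /\ ball_contact x y t.
Proof.
intros Hp b.
destruct (pair_recurrent1 _ _ _ _ Hp (Rmax 0 b)) as [t1 [H1 E1]].
destruct (pair_recurrent2 _ _ _ _ Hp t1) as [t2 [H2 E2]].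
generalize (Rmax_l 0 b) (Rmax_r 0 b); intros Hl Hr.
destruct (crossing_between _ _ _ _ t1 t2 Hp) as [t [Ht E]]; [lra|auto|].
exists t; split; [lra|split; [lra|now apply (proj2 (upper_eq_lower _ _ _))]].
Qed.

Lemma ball_contact_velocity (g : R) (f x y : R -> R) (t v w : R) :
  x t = y t -> bouncing_at g f x t v v -> bouncing_at g f y t w w ->
  velocity_after (upper x y) t (Rmax v w).
Proof.
intros E Hv Hw; apply (launches_velocity g).
now apply (upper_lower_crossing g f).
Qed.

Lemma plate_contact_velocity1 (g : R) (f x y : R -> R) (t v w : R) :
  generic_pair g f x y -> 0 < t -> x t = f t -> bouncing_at g f x t v w ->
  plate_contact f (lower x y) t /\ velocity_after (lower x y) t w.
Proof.
intros [Bx By Hno _ _ _] Ht E B.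
assert (H : x t < y t).
{ generalize (bouncing_above _ _ _ _ By (Rlt_le _ _ Ht)) (Hno t (Rlt_le _ _ Ht) E); lra. }
split; [split; [exact Ht|unfold lower; rewrite Rmin_left; lra]|].
apply (locally_lt_of_bouncing g f) in H; auto; [|lra].
destruct (upper_lower_separated _ _ _ H) as [_ [_ Hl]].
apply (bouncing_at_ext_loc g f _ _ _ _ _ Hl) in B.
apply (launches_velocity g), B.
Qed.

Lemma plate_contact_velocity2 (g : R) (f x y : R -> R) (t v w : R) :
  generic_pair g f x y -> 0 < t -> y t = f t -> bouncing_at g f y t v w ->
  plate_contact f (lower x y) t /\ velocity_after (lower x y) t w.
Proof.
intros [Bx By Hno _ _ _] Ht E B.
assert (H : y t < x t).
{ destruct (bouncing_above _ _ _ _ Bx (Rlt_le _ _ Ht)) as [H|H]; [lra|].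
  destruct (Hno t (Rlt_le _ _ Ht)); congruence. }
split; [split; [exact Ht|unfold lower; rewrite Rmin_right; lra]|].
apply (locally_lt_of_bouncing g f) in H; auto; [|lra].
destruct (upper_lower_separated _ _ _ H) as [[_ Hl] _].
apply (bouncing_at_ext_loc g f _ _ _ _ _ Hl) in B.
apply (launches_velocity g), B.
Qed.

Lemma plate_contact_cases (f x y : R -> R) (t : R) :
  plate_contact f (lower x y) t -> 0 < t /\ (x t = f t \/ y t = f t).
Proof. intros [Ht H]; unfold lower, Rmin in H; destruct Rle_dec; auto. Qed.

Lemma generic_pair_motion (g m : R) (f x y : R -> R) :
  0 < m -> generic_pair g f x y ->
  two_ball_motion g m m f (upper x y) (lower x y) /\
  (exists V1, event_velocities (upper x y) (ball_contact x y) V1) /\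
  (exists V2, event_velocities (lower x y) (plate_contact f (lower x y)) V2).
Proof.
intros Hm Hp; split; [|split].
- destruct Hp; now apply superposed_motion.
- apply event_velocities_exist.
  + now apply (ball_contacts_no_accumulation g f).
  + now intros t [Ht _].
  + now apply (ball_contacts_unbounded g f).
  + intros t [Ht E]; apply (proj1 (upper_eq_lower _ _ _)) in E.
    destruct (pair_crossing_velocities _ _ _ _ _ Hp (Rlt_le _ _ Ht) E) as [_ [v [w [Hv [Hw _]]]]].
    exists (Rmax v w); now apply (ball_contact_velocity g f).
- apply event_velocities_exist.
  + now apply (plate_contacts_no_accumulation g).
  + now intros t [Ht _].
  + intros b; destruct (pair_recurrent1 _ _ _ _ Hp (Rmax 0 b)) as [t [Ht E]].
    generalize (Rmax_l 0 b) (Rmax_r 0 b); intros Hl Hr.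
    destruct (pair_bouncing1 _ _ _ _ Hp t) as [v [w B]]; [lra|].
    exists t; split; [lra|].
    eapply (plate_contact_velocity1 g); eauto; lra.
  + intros t H; apply plate_contact_cases in H; destruct H as [Ht [E|E]].
    * destruct (pair_bouncing1 _ _ _ _ Hp t) as [v [w B]]; [lra|].
      exists w; eapply (plate_contact_velocity1 g f); eauto.
    * destruct (pair_bouncing2 _ _ _ _ Hp t) as [v [w B]]; [lra|].
      exists w; eapply (plate_contact_velocity2 g f); eauto.
Qed.

(** * Smooth periodic functions *)

Lemma periodic_nat (T : R) (f : R -> R) :
  periodic T f -> forall n t, f (t + T * INR n) = f t.
Proof.
intros Hf n; induction n as [|n IH]; intros t.
- simpl; f_equal; ring.
- rewrite S_INR, <- (IH t), <- (Hf (t + T * INR n)); f_equal; ring.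
Qed.

Lemma periodic_Z (T : R) (f : R -> R) :
  periodic T f -> forall n t, f (t + T * IZR n) = f t.
Proof.
intros Hf n t; destruct (Z.le_gt_cases 0 n) as [Hn|Hn].
- rewrite <- (Z2Nat.id n), <- INR_IZR_INZ by lia; now apply periodic_nat.
- rewrite <- (periodic_nat T f Hf (Z.to_nat (- n)) (t + T * IZR n)).
  rewrite INR_IZR_INZ, Z2Nat.id, opp_IZR by lia; f_equal; ring.
Qed.

Lemma periodic_Derive (T : R) (f : R -> R) : periodic T f -> periodic T (Derive f).
Proof.
intros Hf t.
change (Derive f (t + T)) with (Derive_n f 1 (t + T)).
rewrite <- Derive_n_comp_trans; simpl; now apply Derive_ext.
Qed.

Lemma periodic_representative (T : R) (f : R -> R) (t : R) :
  0 < T -> periodic T f -> exists u, 0 <= u <= T /\ f u = f t.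
Proof.
intros HT Hf; destruct (archimed (t / T)) as [H1 H2].
exists (t + T * IZR (1 - up (t / T))); split; [|now apply periodic_Z].
rewrite minus_IZR; set (r := t / T) in *.
replace t with (r * T) by (unfold r; field; lra); nra.
Qed.

Lemma smooth_ex_derive (f : R -> R) (t : R) : smooth f -> ex_derive f t.
Proof. intros Hf; exact (Hf 1%nat t). Qed.

Lemma smooth_continuity_pt (f : R -> R) (t : R) : smooth f -> continuity_pt f t.
Proof.
intros Hf; apply continuity_pt_filterlim.
now apply (ex_derive_continuous (K := R_AbsRing) (V := R_NormedModule)), smooth_ex_derive.
Qed.

Lemma smooth_periodic_lipschitz (T : R) (f : R -> R) :
  0 < T -> smooth f -> periodic T f ->
  exists M, forall a b, Rabs (f b - f a) <= M * Rabs (b - a).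
Proof.
intros HT Hs Hp.
assert (Hc : forall t, continuity_pt (fun u => Rabs (Derive f u)) t).
{ intros t; apply (continuity_pt_comp (Derive f) Rabs); [|apply Rcontinuity_abs].
  apply continuity_pt_filterlim.
  apply (ex_derive_continuous (K := R_AbsRing) (V := R_NormedModule)).
  exact (Hs 2%nat t). }
destruct (continuity_ab_maj (fun u => Rabs (Derive f u)) 0 T) as [m [Hm _]];
  [lra|intros; apply Hc|].
exists (Rabs (Derive f m)); intros a b.
destruct (MVT_gen f a b (Derive f)) as [c [_ ->]].
- intros u _; now apply Derive_correct, smooth_ex_derive.
- intros u _; now apply smooth_continuity_pt.
- rewrite Rabs_mult; apply Rmult_le_compat_r; [apply Rabs_pos|].
  destruct (periodic_representative T (Derive f) c HT (periodic_Derive _ _ Hp)) as [u [Hu <-]].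
  now apply Hm.
Qed.

Lemma smooth_periodic_critical_point (T : R) (f : R -> R) :
  0 < T -> smooth f -> periodic T f -> exists t, Derive f t = 0.
Proof.
intros HT Hs Hp.
pose (pr := fun u (_ : 0 < u < T) =>
  ex_derive_Reals_0 f u (smooth_ex_derive f u Hs)).
destruct (Rolle f 0 T pr) as [c [Hc E]].
- intros u _; now apply smooth_continuity_pt.
- exact HT.
- now rewrite <- (Hp 0), Rplus_0_l.
- exists c; rewrite <- E; symmetry; apply Derive_Reals.
Qed.

(** * Balls whose bounces all occur at one height of the plate *)

(** The free flight from height [h] at time [a] to height [h] at time [b]. *)
Definition arc (g h a b t : R) : R := h + g / 2 * (t - a) * (b - t).

(** Starting before time [0] spares the endpoint [0] a separate treatment. *)
Record level_ball (g : R) (f : R -> R) (h : R) (s : nat -> R) (x : R -> R) : Prop := {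
  level_start : s 0%nat < 0;
  level_increasing : forall k, s k < s (S k);
  level_unbounded : forall b, exists k, b < s k;
  level_height : forall k, f (s k) = h;
  level_arc : forall k t, s k <= t <= s (S k) -> x t = arc g h (s k) (s (S k)) t;
  level_above : forall k t, s k < t < s (S k) -> f t < x t;
  level_law : forall k, g / 2 * (s (S (S k)) - s (S k)) =
                        g / 2 * (s (S k) - s k) + 2 * Derive f (s (S k))
}.

Lemma time_in_gap (s : nat -> R) (t : R) :
  (forall b, exists k, b < s k) -> s 0%nat <= t -> exists k, s k <= t < s (S k).
Proof.
intros Hinf H0; apply NNPP; intros Hno.
destruct (Hinf t) as [k Hk]; revert Hk; apply Rle_not_lt.
induction k as [|k IH]; [exact H0|].
apply Rnot_lt_le; intros H; apply Hno; exists k; lra.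
Qed.

Lemma glue_on_gaps (s : nat -> R) (p : nat -> R -> R) :
  (forall k, s k < s (S k)) -> (forall b, exists k, b < s k) ->
  (forall k, p k (s (S k)) = p (S k) (s (S k))) ->
  exists x, forall k t, s k <= t <= s (S k) -> x t = p k t.
Proof.
intros Hs Hinf Hp.
destruct (choice (fun t y => forall k, s k <= t < s (S k) -> y = p k t)) as [x Hx].
- intros t; destruct (classic (exists k, s k <= t < s (S k))) as [[k Hk]|Hno].
  + exists (p k t); intros j Hj.
    assert (Hlt := increasing_sequence_lt s Hs).
    assert (k < S j)%nat by (apply Hlt; lra); assert (j < S k)%nat by (apply Hlt; lra).
    now replace j with k by lia.
  + exists 0; intros k Hk; elim Hno; eauto.
- exists x; intros k t Ht; destruct (Req_dec t (s (S k))) as [->|Hne].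
  + rewrite Hp; apply Hx; split; [lra|apply Hs].
  + apply Hx; lra.
Qed.

(** Near its ends an arc of duration [b - a] has slopes close to [g (b - a) / 2],
    and by concavity it stays above the two chords of slope [g (b - a) / 4] to its
    top; a plate slower than that stays below. *)
Lemma arc_above_plate (g M h a b u : R) (f : R -> R) :
  0 < g -> (forall c d, Rabs (f d - f c) <= M * Rabs (d - c)) ->
  f a = h -> f b = h -> 4 * M < g * (b - a) -> a < u < b -> f u < arc g h a b u.
Proof.
intros Hg Hlip Ha Hb HM Hu; unfold arc.
assert (Hua := Rle_trans _ _ _ (Rle_abs _) (Hlip a u)).
assert (Hub := Rle_trans _ _ _ (Rle_abs _) (Hlip b u)).
rewrite (Rabs_right (u - a)) in Hua by lra.
rewrite (Rabs_left (u - b)) in Hub by lra.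
destruct (Rle_lt_dec (u - a) (b - u)) as [H|H].
- assert (0 <= (u - a) * (g * ((b - u) - (u - a)))) by (apply Rmult_le_pos; nra).
  assert (0 < (u - a) * (g * (b - a) - 4 * M)) by (apply Rmult_lt_0_compat; lra).
  lra.
- assert (0 <= (b - u) * (g * ((u - a) - (b - u)))) by (apply Rmult_le_pos; nra).
  assert (0 < (b - u) * (g * (b - a) - 4 * M)) by (apply Rmult_lt_0_compat; lra).
  lra.
Qed.

Lemma level_ball_exists (g M P c : R) (f : R -> R) (n : nat -> nat) :
  0 < g -> 0 < P -> (forall a b, Rabs (f b - f a) <= M * Rabs (b - a)) -> periodic P f ->
  c + P * INR (n 0%nat) < 0 ->
  (forall k, (n k < n (S k))%nat) ->
  (forall k, 4 * M < g * P * (INR (n (S k)) - INR (n k))) ->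
  (forall k, g * P / 2 * (INR (n (S (S k))) - 2 * INR (n (S k)) + INR (n k)) = 2 * Derive f c) ->
  exists x, level_ball g f (f c) (fun k => c + P * INR (n k)) x.
Proof.
intros Hg HP Hlip Hper H0 Hn HM Hlaw.
set (s := fun k => c + P * INR (n k)).
assert (Hs : forall k, s k < s (S k)).
{ intros k; unfold s; apply Rplus_lt_compat_l, Rmult_lt_compat_l; [exact HP|].
  apply lt_INR, Hn. }
assert (Hle : forall k, (k <= n k)%nat).
{ induction k as [|k IH]; [lia|generalize (Hn k); lia]. }
assert (Hinf : forall b, exists k, b < s k).
{ intros b; destruct (INR_unbounded ((b - c) / P)) as [k Hk]; exists k; unfold s.
  assert (Hk' := le_INR _ _ (Hle k)).
  assert (b - c < INR k * P) by (apply Rlt_div_l; assumption).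
  nra. }
assert (Hh : forall k, f (s k) = f c) by (intros k; now apply periodic_nat).
destruct (glue_on_gaps s (fun k => arc g (f c) (s k) (s (S k)))) as [x Hx]; auto.
{ intros k; unfold arc; ring. }
exists x; split; auto.
- intros k t Ht; rewrite (Hx k) by lra.
  apply (arc_above_plate g M); auto.
  replace (s (S k) - s k) with (P * (INR (n (S k)) - INR (n k))) by (unfold s; ring).
  specialize (HM k); lra.
- intros k; unfold s at 5; rewrite (periodic_nat P (Derive f)), <- (Hlaw k)
    by now apply periodic_Derive.
  unfold s; field.
Qed.

Section LevelBall.

Context {g : R} {f : R -> R} {h : R} {s : nat -> R} {x : R -> R}.
Hypothesis Hball : level_ball g f h s x.

Lemma level_ball_phase (t : R) : 0 <= t -> exists k, s k <= t < s (S k).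
Proof.
intros Ht; apply time_in_gap; [apply Hball|].
generalize (level_start _ _ _ _ _ Hball); lra.
Qed.

Lemma level_ball_in_flight (k : nat) (t : R) :
  s k < t < s (S k) ->
  bouncing_at g f x t (g * ((s k + s (S k)) / 2 - t)) (g * ((s k + s (S k)) / 2 - t)).
Proof.
intros Ht.
assert (Hlt : locally t (fun u => s k < u)) by now apply (open_gt (s k)).
assert (Hgt : locally t (fun u => u < s (S k))) by now apply (open_lt (s (S k))).
assert (Hloc := filter_and _ _ Hlt Hgt).
assert (Hx : locally t (fun u => x u = parabola g x t (g * ((s k + s (S k)) / 2 - t)) u)).
{ revert Hloc; apply filter_imp; intros u Hu; unfold parabola.
  rewrite !(level_arc _ _ _ _ _ Hball k) by lra; unfold arc; field. }
split; [now apply at_left_of_locally|split; [now apply at_right_of_locally|split]].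
- unfold locally', within; revert Hloc; apply filter_imp; intros u Hu _.
  now apply (level_above _ _ _ _ _ Hball k).
- left; split; [now apply (level_above _ _ _ _ _ Hball k)|reflexivity].
Qed.

Lemma level_ball_at_bounce (k : nat) :
  bouncing_at g f x (s (S k)) (- (g / 2 * (s (S k) - s k))) (g / 2 * (s (S (S k)) - s (S k))).
Proof.
assert (H1 : 0 < s (S k) - s k) by (generalize (level_increasing _ _ _ _ _ Hball k); lra).
assert (H2 : 0 < s (S (S k)) - s (S k))
  by (generalize (level_increasing _ _ _ _ _ Hball (S k)); lra).
assert (Harc := level_arc _ _ _ _ _ Hball).
assert (Habove := level_above _ _ _ _ _ Hball).
assert (Hl : at_left (s (S k)) (fun u => s k < u < s (S k))).
{ apply at_left_iff_ball; exists (mkposreal _ H1); simpl.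
  intros u; lra. }
assert (Hr : at_right (s (S k)) (fun u => s (S k) < u < s (S (S k)))).
{ apply at_right_iff_ball; exists (mkposreal _ H2); simpl.
  intros u; lra. }
unfold bouncing_at, lands, launches.
split; [|split; [|split]].
- revert Hl; apply filter_imp; intros u Hu; unfold parabola.
  rewrite !(Harc k) by lra; unfold arc; field.
- revert Hr; apply filter_imp; intros u Hu; unfold parabola.
  rewrite !(Harc (S k)) by lra; unfold arc; field.
- apply punctured_of_sides; [revert Hl|revert Hr]; apply filter_imp; apply Habove.
- right; split.
  + rewrite (Harc k), (level_height _ _ _ _ _ Hball) by lra; unfold arc; ring.
  + rewrite (level_law _ _ _ _ _ Hball); ring.
Qed.

Lemma level_ball_cases (t : R) :
  0 <= t -> (exists k, s k < t < s (S k)) \/ (exists k, t = s (S k)).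
Proof.
intros Ht; destruct (level_ball_phase t Ht) as [k Hk].
destruct (Req_dec t (s k)) as [E|Hne]; [right|left; exists k; lra].
destruct k as [|k]; [|now exists k].
generalize (level_start _ _ _ _ _ Hball); lra.
Qed.

Lemma level_ball_bouncing : bouncing g f x.
Proof.
intros t Ht; destruct (level_ball_cases t Ht) as [[k Hk]|[k ->]].
- now eexists; eexists; apply (level_ball_in_flight k).
- now eexists; eexists; apply level_ball_at_bounce.
Qed.

Lemma level_ball_on_plate (k : nat) : x (s k) = f (s k).
Proof.
assert (H := level_increasing _ _ _ _ _ Hball k).
rewrite (level_arc _ _ _ _ _ Hball k), (level_height _ _ _ _ _ Hball) by lra.
unfold arc; ring.
Qed.

Lemma level_ball_plate_times (t : R) :
  0 <= t -> x t = f t -> exists k, t = s (S k).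
Proof.
intros Ht E; destruct (level_ball_cases t Ht) as [[k Hk]|H]; [|exact H].
generalize (level_above _ _ _ _ _ Hball k t Hk); lra.
Qed.

Lemma level_ball_recurrent (b : R) : exists t, b < t /\ x t = f t.
Proof.
destruct (level_unbounded _ _ _ _ _ Hball b) as [k Hk].
exists (s k); split; [exact Hk|apply level_ball_on_plate].
Qed.

(** Conservation of energy; the first two terms of the sum are the peak height of
    the flight. *)
Lemma level_ball_energy (t v : R) :
  0 < g -> 0 <= t -> bouncing_at g f x t v v -> f t < x t ->
  exists k, x t = h + g * (s (S k) - s k) ^ 2 / 8 - v ^ 2 / (2 * g).
Proof.
intros Hg Ht B Hf; destruct (level_ball_cases t Ht) as [[k Hk]|[k ->]].
- exists k.
  rewrite (velocity_after_unique x t v (g * ((s k + s (S k)) / 2 - t))).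
  + rewrite (level_arc _ _ _ _ _ Hball k) by lra; unfold arc; field; lra.
  + apply (launches_velocity g), B.
  + apply (launches_velocity g), (level_ball_in_flight k t Hk).
- rewrite level_ball_on_plate in Hf; lra.
Qed.

End LevelBall.

(** The last hypothesis says that no flight of one ball peaks at the same height
    as a flight of the other, as balls touching with equal velocities would by
    conservation of energy. *)
Lemma level_balls_generic (g : R) (f : R -> R) (h h' : R) (s s' : nat -> R) (x y : R -> R) :
  0 < g -> level_ball g f h s x -> level_ball g f h' s' y ->
  (forall i j, s i <> s' j) ->
  (forall i j, h + g * (s (S i) - s i) ^ 2 / 8 <> h' + g * (s' (S j) - s' j) ^ 2 / 8) ->
  generic_pair g f x y.
Proof.
intros Hg Hx Hy Hdis Hpeak.
assert (Hno : forall t, 0 <= t -> x t = f t -> y t <> f t).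
{ intros t Ht Ex Ey.
  destruct (level_ball_plate_times Hx t Ht Ex) as [i Ei].
  destruct (level_ball_plate_times Hy t Ht Ey) as [j Ej].
  apply (Hdis (S i) (S j)); congruence. }
assert (Bx := level_ball_bouncing Hx); assert (By := level_ball_bouncing Hy).
split; auto; [|apply (level_ball_recurrent Hx)|apply (level_ball_recurrent Hy)].
intros t v Ht E Hv Hw.
assert (Hf : f t < x t).
{ destruct (bouncing_above _ _ _ _ Bx Ht) as [H|H]; [exact H|].
  destruct (Hno t Ht); congruence. }
destruct (level_ball_energy Hx t v Hg Ht Hv Hf) as [i Hi].
rewrite E in Hf; destruct (level_ball_energy Hy t v Hg Ht Hw Hf) as [j Hj].
apply (Hpeak i j); lra.
Qed.

(** * Superposition of a rising and a low ball *)

Lemma level_ball_tail (g : R) (f x : R -> R) (h : R) (s : nat -> R) (b : R) :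
  level_ball g f h s x -> exists k0, forall k, (k0 <= k)%nat -> b < s k.
Proof.
intros Hx; destruct (level_unbounded _ _ _ _ _ Hx b) as [k0 H0]; exists k0.
intros k Hk; induction Hk as [|k Hk IH]; [exact H0|].
generalize (level_increasing _ _ _ _ _ Hx k); lra.
Qed.

(** Closed intervals are enough: at an endpoint one ball would be on the plate, and
    hence below the other. *)
Lemma crossing_in_flight (g : R) (f x y : R -> R) (h h' : R) (s s' : nat -> R) (i j : nat) (t : R) :
  generic_pair g f x y -> level_ball g f h s x -> level_ball g f h' s' y ->
  0 < t -> s i <= t <= s (S i) -> s' j <= t <= s' (S j) -> x t = y t ->
  ball_contact x y t /\
  velocity_after (upper x y) t
    (Rmax (g * ((s i + s (S i)) / 2 - t)) (g * ((s' j + s' (S j)) / 2 - t))).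
Proof.
intros Hp Hx Hy Ht Hi Hj E; split; [split; [exact Ht|now apply (proj2 (upper_eq_lower _ _ _))]|].
destruct (pair_crossing_velocities _ _ _ _ _ Hp (Rlt_le _ _ Ht) E) as [Hf _].
assert (Hxs : forall k, t <> s k).
{ intros k Ek; generalize (level_ball_on_plate Hx k); rewrite <- Ek; lra. }
assert (Hys : forall k, t <> s' k).
{ intros k Ek; generalize (level_ball_on_plate Hy k); rewrite <- Ek; lra. }
generalize (Hxs i) (Hxs (S i)) (Hys j) (Hys (S j)); intros.
apply (ball_contact_velocity g f); auto.
- apply (level_ball_in_flight Hx); lra.
- apply (level_ball_in_flight Hy); lra.
Qed.

Section RisingAndLow.

Context {g h h' D : R} {f x y : R -> R} {s s' : nat -> R}.
Hypothesis Hg : 0 < g.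
Hypothesis Hpair : generic_pair g f x y.
Hypothesis Hx : level_ball g f h s x.
Hypothesis Hy : level_ball g f h' s' y.
Hypothesis Hlow : forall k, s' (S k) - s' k = D.
Hypothesis Hrise : forall B, exists k0, forall k, (k0 <= k)%nat -> B < s (S k) - s k.

Lemma rising_flight_after (b B : R) : exists k, b < s k /\ B < s (S k) - s k.
Proof.
destruct (level_ball_tail _ _ _ _ _ b Hx) as [k1 H1]; destruct (Hrise B) as [k2 H2].
exists (k1 + k2)%nat; split; [apply H1|apply H2]; lia.
Qed.

Lemma low_period_pos : 0 < D.
Proof. generalize (level_increasing _ _ _ _ _ Hy 0%nat) (Hlow 0%nat); lra. Qed.

(** Just after a bounce of the rising ball the low one comes down to the plate:
    they cross while the rising ball is still fast. *)
Lemma fast_ball_contact (M b : R) :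
  exists t v, b < t /\ ball_contact x y t /\ velocity_after (upper x y) t v /\ M < Rabs v.
Proof.
assert (HD := low_period_pos).
generalize (Rmax_l 0 b) (Rmax_r 0 b); intros Hl Hr.
destruct (rising_flight_after (Rmax 0 b) (Rmax (2 * D) (2 * (M / g + D)))) as [i [Hi HBi]].
generalize (Rmax_l (2 * D) (2 * (M / g + D))) (Rmax_r (2 * D) (2 * (M / g + D))); intros.
destruct (level_ball_phase Hy (s i)) as [j Hj]; [lra|].
assert (Hlen := Hlow j).
destruct (crossing_between _ _ _ _ (s i) (s' (S j)) Hpair) as [t [Ht E]]; [lra| |].
{ left; split; [apply (level_ball_on_plate Hx)|apply (level_ball_on_plate Hy)]. }
destruct (crossing_in_flight _ _ _ _ _ _ _ _ i j t Hpair Hx Hy) as [Hc Hv]; try lra.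
exists t; eexists; split; [|split; [exact Hc|split; [exact Hv|]]]; [lra|].
eapply Rlt_le_trans; [|apply Rle_abs].
eapply Rlt_le_trans; [|apply Rmax_l].
replace M with (g * (M / g)) at 1 by (field; lra).
apply Rmult_lt_compat_l; lra.
Qed.

(** Just before a bounce of the rising ball it overtakes the low one downwards,
    and the ball sent up is the low one. *)
Lemma slow_ball_contact (b : R) :
  exists t v, b < t /\ ball_contact x y t /\ velocity_after (upper x y) t v /\
              Rabs v <= g * D / 2.
Proof.
assert (HD := low_period_pos).
generalize (Rmax_l 0 b) (Rmax_r 0 b); intros Hl Hr.
destruct (rising_flight_after (Rmax 0 b) (3 * D)) as [i [Hi HBi]].
destruct (level_ball_phase Hy (s (S i))) as [j Hj]; [lra|].
assert (Hlen := Hlow j).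
assert (Hne : s' j <> s (S i)).
{ intros E; apply (pair_no_triple _ _ _ _ Hpair (s' j)); [lra| |].
  - rewrite E; apply (level_ball_on_plate Hx).
  - apply (level_ball_on_plate Hy). }
destruct (crossing_between _ _ _ _ (s' j) (s (S i)) Hpair) as [t [Ht E]]; [lra| |].
{ right; split; [apply (level_ball_on_plate Hy)|apply (level_ball_on_plate Hx)]. }
destruct (crossing_in_flight _ _ _ _ _ _ _ _ i j t Hpair Hx Hy) as [Hc Hv]; try lra.
exists t; eexists; split; [|split; [exact Hc|split; [exact Hv|]]]; [lra|].
rewrite Rmax_right by (apply Rmult_le_compat_l; lra).
rewrite Rabs_mult, (Rabs_right g) by lra.
replace (g * D / 2) with (g * (D / 2)) by field.
apply Rmult_le_compat_l; [lra|apply Rabs_le; lra].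
Qed.

Lemma fast_plate_contact (M b : R) :
  exists t v, b < t /\ plate_contact f (lower x y) t /\ velocity_after (lower x y) t v /\
              M < Rabs v.
Proof.
destruct (level_ball_tail _ _ _ _ _ (Rmax 0 b) Hx) as [k1 H1].
destruct (Hrise (2 * (M / g))) as [k2 H2].
set (i := (k1 + k2)%nat).
assert (Hb : Rmax 0 b < s (S i)) by (apply H1; unfold i; lia).
assert (Hl : 2 * (M / g) < s (S (S i)) - s (S i)) by (apply H2; unfold i; lia).
generalize (Rmax_l 0 b) (Rmax_r 0 b); intros.
assert (Hpos : 0 < s (S i)) by lra.
destruct (plate_contact_velocity1 g f x y _ _ _ Hpair Hpos (level_ball_on_plate Hx (S i))
            (level_ball_at_bounce Hx i)) as [Hc Hv].
exists (s (S i)); eexists; split; [|split; [exact Hc|split; [exact Hv|]]]; [lra|].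
eapply Rlt_le_trans; [|apply Rle_abs].
replace M with (g / 2 * (2 * (M / g))) at 1 by (field; lra).
apply Rmult_lt_compat_l; lra.
Qed.

Lemma slow_plate_contact (b : R) :
  exists t v, b < t /\ plate_contact f (lower x y) t /\ velocity_after (lower x y) t v /\
              Rabs v <= g * D / 2.
Proof.
assert (HD := low_period_pos).
destruct (level_ball_tail _ _ _ _ _ (Rmax 0 b) Hy) as [i H1].
assert (Hb : Rmax 0 b < s' (S i)) by (apply H1; lia).
generalize (Rmax_l 0 b) (Rmax_r 0 b); intros.
assert (Hpos : 0 < s' (S i)) by lra.
destruct (plate_contact_velocity2 g f x y _ _ _ Hpair Hpos (level_ball_on_plate Hy (S i))
            (level_ball_at_bounce Hy i)) as [Hc Hv].
exists (s' (S i)); eexists; split; [|split; [exact Hc|split; [exact Hv|]]]; [lra|].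
rewrite Hlow, Rabs_right; [lra|].
apply Rle_ge, Rmult_le_pos; lra.
Qed.

End RisingAndLow.

(** * Resonant balls *)

(** With [e = 1] and [e = 0] the bounces of two balls alternate, each one
    occurring about when the other ball is at its top. *)
Definition resonant_time (c P : R) (N e k : nat) : R :=
  c + P * INR ((N + k) * (N + k + e)).

Lemma resonant_time_expand (c P : R) (N e k : nat) :
  resonant_time c P N e k = c + P * ((INR N + INR k) * (INR N + INR k + INR e)).
Proof. unfold resonant_time; now rewrite mult_INR, !plus_INR. Qed.

Lemma resonant_gap (c P : R) (N e k : nat) :
  resonant_time c P N e (S k) - resonant_time c P N e k =
  P * INR (2 * (N + k) + 1 + e).
Proof.
rewrite !resonant_time_expand, S_INR, !plus_INR, mult_INR, plus_INR; simpl; ring.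
Qed.

(** Successive flights differ by two periods [P], which is what the plate adds
    at each bounce: its velocity [P g / 2] increases the velocity of the ball by
    [P g], and the duration of the flight by [2 P]. *)
Lemma resonant_ball_exists (g M P c : R) (f : R -> R) (N e : nat) :
  0 < g -> 0 < P -> (forall a b, Rabs (f b - f a) <= M * Rabs (b - a)) -> periodic P f ->
  Derive f c = P * g / 2 -> 4 * M < g * P * INR N ->
  c + P * INR (N * (N + e)) < 0 ->
  exists x, level_ball g f (f c) (resonant_time c P N e) x.
Proof.
intros Hg HP Hlip Hper Hc HM H0.
assert (HgP : 0 < g * P) by now apply Rmult_lt_0_compat.
apply (level_ball_exists g M P c f (fun k => (N + k) * (N + k + e))%nat); auto.
- now rewrite !Nat.add_0_r.
- intros k; nia.
- intros k; apply Rlt_le_trans with (1 := HM), Rmult_le_compat_l; [lra|].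
  rewrite !mult_INR, !plus_INR, S_INR.
  generalize (pos_INR N) (pos_INR k) (pos_INR e); intros; lra.
- intros k; rewrite Hc, !mult_INR, !plus_INR, !S_INR; field.
Qed.

Lemma resonant_gap_unbounded (c P : R) (N e : nat) (B : R) :
  0 < P -> exists k0, forall k, (k0 <= k)%nat ->
  B < resonant_time c P N e (S k) - resonant_time c P N e k.
Proof.
intros HP; destruct (INR_unbounded (B / P)) as [k0 Hk0]; exists k0; intros k Hk.
rewrite resonant_gap.
replace B with (P * (B / P)) by (field; lra).
apply Rmult_lt_compat_l; [exact HP|]; apply Rlt_le_trans with (1 := Hk0), le_INR; lia.
Qed.

Lemma rational_time_injective (c P : R) (a b : nat) :
  0 < P -> c + P * INR a = c + P * INR b -> a = b.
Proof.
intros HP E; apply INR_eq, (Rmult_eq_reg_l P); lra.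
Qed.

Lemma resonant_pair_generic (g P c : R) (f x y : R -> R) (N : nat) :
  0 < g -> 0 < P -> (0 < N)%nat ->
  level_ball g f (f c) (resonant_time c P N 1) x ->
  level_ball g f (f c) (resonant_time c P N 0) y ->
  generic_pair g f x y.
Proof.
intros Hg HP HN Hx Hy; apply (level_balls_generic _ _ _ _ _ _ _ _ Hg Hx Hy).
- (* A product of two consecutive positive integers is not a square. *)
  intros i j E; apply rational_time_injective in E; [|exact HP].
  destruct (Nat.le_gt_cases (N + j) (N + i)); nia.
- intros i j; rewrite !resonant_gap; intros E.
  apply Rplus_eq_reg_l in E.
  assert (E2 : Rsqr (INR (2 * (N + i) + 1 + 1)) = Rsqr (INR (2 * (N + j) + 1 + 0))).
  { unfold Rsqr; apply (Rmult_eq_reg_l (g * P ^ 2 / 8)); [lra|].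
    assert (0 < P ^ 2) by now apply pow_lt.
    assert (0 < g * P ^ 2) by now apply Rmult_lt_0_compat.
    lra. }
  apply Rsqr_inj, INR_eq in E2; [lia|apply pos_INR|apply pos_INR].
Qed.

(** With respect to the bounce of [y] which occurs in the middle of the flight of
    [x], the equation of the crossing is linear, since both parabolas have the same
    curvature.  For [r = N + k] the crossing is at the distance
    [P (r + 1) ^ 2 / (2 r + 1)] before, or [P (r + 1) ^ 2 / (2 r + 3)] after, that
    bounce: about [P r / 2], while the flights last about [2 P r]. *)
Lemma resonant_crossing_fast (g P c : R) (f x y : R -> R) (N k : nat) (t : R) :
  0 < g -> 0 < P -> (0 < N)%nat ->
  level_ball g f (f c) (resonant_time c P N 1) x ->
  level_ball g f (f c) (resonant_time c P N 0) y ->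
  0 < t -> resonant_time c P N 1 k <= t <= resonant_time c P N 1 (S k) -> x t = y t ->
  exists v, velocity_after (upper x y) t v /\ g * P * INR k / 2 <= v.
Proof.
intros Hg HP HN Hx Hy Ht Hk E.
assert (Hp := resonant_pair_generic _ _ _ _ _ _ _ Hg HP HN Hx Hy).
assert (HgP : 0 < g * P) by now apply Rmult_lt_0_compat.
assert (HgPP : 0 < g * P * P) by now apply Rmult_lt_0_compat.
pose (r := INR N + INR k).
assert (Hr : INR k <= r) by (generalize (pos_INR N); unfold r; lra).
assert (Hk0 := pos_INR k).
assert (E0 : resonant_time c P N 1 k = c + P * (r * (r + 1))).
{ rewrite resonant_time_expand; unfold r; simpl; ring. }
assert (E1 : resonant_time c P N 1 (S k) = c + P * ((r + 1) * (r + 2))).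
{ rewrite resonant_time_expand, S_INR; unfold r; simpl; ring. }
assert (F0 : resonant_time c P N 0 k = c + P * r ^ 2).
{ rewrite resonant_time_expand; unfold r; simpl; ring. }
assert (F1 : resonant_time c P N 0 (S k) = c + P * (r + 1) ^ 2).
{ rewrite resonant_time_expand, S_INR; unfold r; simpl; ring. }
assert (F2 : resonant_time c P N 0 (S (S k)) = c + P * (r + 2) ^ 2).
{ rewrite resonant_time_expand, !S_INR; unfold r; simpl; ring. }
(* [P q] is the time from [t] to the bounce of [y] which occurs during this
   flight of [x]; it is negative when this bounce has already occurred. *)
pose (q := ((r + 1) ^ 2 - (t - c) / P)).
assert (Et : t = c + P * ((r + 1) ^ 2 - q)) by (unfold q; field; lra).
assert (Hx' := level_arc _ _ _ _ _ Hx k t Hk).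
destruct (Rle_lt_dec 0 q) as [Hq|Hq].
- assert (Hk' : resonant_time c P N 0 k <= t <= resonant_time c P N 0 (S k)).
  { rewrite F0, F1; rewrite E0, E1 in Hk; rewrite Et in Hk |- *; split; nra. }
  assert (Hy' := level_arc _ _ _ _ _ Hy k t Hk').
  destruct (crossing_in_flight _ _ _ _ _ _ _ _ k k t Hp Hx Hy Ht Hk Hk' E) as [_ Hv].
  eexists; split; [exact Hv|].
  eapply Rle_trans; [|apply Rmax_l].
  rewrite E0, E1, Et.
  replace (g * ((c + P * (r * (r + 1)) + (c + P * ((r + 1) * (r + 2)))) / 2 -
                (c + P * ((r + 1) ^ 2 - q)))) with (g * P * q) by field.
  assert (Hq2 : (r + 1) ^ 2 = (2 * r + 1) * q).
  { apply (Rmult_eq_reg_l (g * P * P / 2)); [|lra].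
    rewrite Hx', Hy' in E; unfold arc in E; rewrite E0, E1, F0, F1, Et in E; nra. }
  assert (r / 2 <= q) by nra.
  nra.
- assert (Hk' : resonant_time c P N 0 (S k) <= t <= resonant_time c P N 0 (S (S k))).
  { rewrite F1, F2; rewrite E0, E1 in Hk; rewrite Et in Hk |- *; split; nra. }
  assert (Hy' := level_arc _ _ _ _ _ Hy (S k) t Hk').
  destruct (crossing_in_flight _ _ _ _ _ _ _ _ k (S k) t Hp Hx Hy Ht Hk Hk' E) as [_ Hv].
  eexists; split; [exact Hv|].
  eapply Rle_trans; [|apply Rmax_r].
  rewrite F1, F2, Et.
  replace (g * ((c + P * (r + 1) ^ 2 + (c + P * (r + 2) ^ 2)) / 2 -
                (c + P * ((r + 1) ^ 2 - q)))) with (g * P * (r + 3 / 2 + q)) by field.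
  assert (Hq2 : (r + 1) ^ 2 = - (2 * r + 3) * q).
  { apply (Rmult_eq_reg_l (g * P * P / 2)); [|lra].
    rewrite Hx', Hy' in E; unfold arc in E; rewrite E0, E1, F1, F2, Et in E; nra. }
  assert (- (r + 1) / 2 <= q) by nra.
  nra.
Qed.

(** * Existence of both types of motions *)

(** Balls can be started at any past time congruent to a given one modulo [P]. *)
Lemma time_in_the_past (P t b : R) : 0 < P -> exists n, t + P * IZR n < b.
Proof.
intros HP; exists (- up ((t - b) / P))%Z; rewrite opp_IZR.
destruct (archimed ((t - b) / P)) as [H _].
assert (t - b < IZR (up ((t - b) / P)) * P) by (apply Rlt_div_l; lra).
lra.
Qed.

Lemma resonant_motion (g m P t0 : R) (f : R -> R) :
  0 < g -> 0 < m -> 0 < P -> smooth f -> periodic P f -> Derive f t0 = P * g / 2 ->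
  exists (z1 z2 : R -> R) (V1 V2 : nat -> R),
    two_ball_motion g m m f z1 z2 /\
    ball_velocities z1 z2 V1 /\
    plate_velocities f z2 V2 /\
    is_lim_seq (fun i => Rabs (V1 i)) p_infty /\
    is_lim_seq (fun i => Rabs (V2 i)) p_infty.
Proof.
intros Hg Hm HP Hs Hper H0.
destruct (smooth_periodic_lipschitz P f HP Hs Hper) as [M Hlip].
assert (HgP : 0 < g * P) by now apply Rmult_lt_0_compat.
destruct (INR_unbounded (Rmax 0 (4 * M / (g * P)))) as [N HN].
assert (HN0 : (0 < N)%nat).
{ apply INR_lt; simpl; generalize (Rmax_l 0 (4 * M / (g * P))); lra. }
assert (HNM : 4 * M < g * P * INR N).
{ rewrite (Rmult_comm (g * P)); apply Rlt_div_l; [exact HgP|].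
  generalize (Rmax_r 0 (4 * M / (g * P))); lra. }
destruct (time_in_the_past P t0 (- (P * INR (N * (N + 1)))) HP) as [n Hn].
set (c := t0 + P * IZR n) in *.
assert (Hc : Derive f c = P * g / 2).
{ unfold c; rewrite periodic_Z; [exact H0|now apply periodic_Derive]. }
destruct (resonant_ball_exists g M P c f N 1) as [x Hx]; auto; [lra|].
destruct (resonant_ball_exists g M P c f N 0) as [y Hy]; auto.
{ assert (P * INR (N * (N + 0)) <= P * INR (N * (N + 1))); [|lra].
  apply Rmult_le_compat_l; [lra|apply le_INR; nia]. }
assert (Hp := resonant_pair_generic _ _ _ _ _ _ _ Hg HP HN0 Hx Hy).
destruct (generic_pair_motion g m f x y Hm Hp) as [Hmot [[V1 HV1] [V2 HV2]]].
exists (upper x y), (lower x y), V1, V2.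
split; [exact Hmot|split; [exact HV1|split; [exact HV2|split]]].
- apply event_velocities_lim_infty with (2 := HV1);
    [now apply (ball_contacts_no_accumulation g f)|].
  intros B; destruct (INR_unbounded (2 * B / (g * P))) as [k0 Hk0].
  exists (resonant_time c P N 1 k0); intros t v Hb [Ht E] Hv.
  apply (proj1 (upper_eq_lower _ _ _)) in E.
  destruct (level_ball_phase Hx t (Rlt_le _ _ Ht)) as [k Hk].
  destruct (resonant_crossing_fast g P c f x y N k t) as [v' [Hv' Hle]]; auto; [lra|].
  rewrite (velocity_after_unique _ _ _ _ Hv Hv').
  apply Rlt_le_trans with (2 := Rle_abs _), Rlt_le_trans with (2 := Hle).
  assert (Hkk : (k0 < S k)%nat).
  { apply (increasing_sequence_lt _ (level_increasing _ _ _ _ _ Hx)); lra. }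
  assert (INR k0 <= INR k) by (apply le_INR; lia).
  assert (2 * B < INR k0 * (g * P)) by (apply Rlt_div_l; assumption).
  nra.
- apply event_velocities_lim_infty with (2 := HV2);
    [now apply (plate_contacts_no_accumulation g)|].
  intros B.
  assert (Hfast : forall e z, level_ball g f (f c) (resonant_time c P N e) z ->
    exists b, forall t v, b < t -> 0 < t -> z t = f t ->
      (forall u w, bouncing_at g f z t u w -> velocity_after (lower x y) t w) ->
      velocity_after (lower x y) t v -> B < Rabs v).
  { intros e z Hz.
    destruct (resonant_gap_unbounded c P N e (2 * (B / g)) HP) as [k0 Hk0].
    exists (resonant_time c P N e k0); intros t v Hb Ht E Hw Hv.
    destruct (level_ball_plate_times Hz t (Rlt_le _ _ Ht) E) as [k ->].
    assert (Hkk : (k0 < S k)%nat).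
    { apply (increasing_sequence_lt _ (level_increasing _ _ _ _ _ Hz)); lra. }
    apply Nat.lt_le_incl, Hk0 in Hkk.
    rewrite (velocity_after_unique _ _ _ _ Hv (Hw _ _ (level_ball_at_bounce Hz k))).
    apply Rlt_le_trans with (2 := Rle_abs _).
    replace B with (g / 2 * (2 * (B / g))) at 1 by (field; lra).
    apply Rmult_lt_compat_l; lra. }
  destruct (Hfast _ _ Hx) as [b1 Hb1]; destruct (Hfast _ _ Hy) as [b2 Hb2].
  exists (Rmax b1 b2); intros t v Hb Hc' Hv.
  generalize (Rmax_l b1 b2) (Rmax_r b1 b2); intros.
  destruct (plate_contact_cases _ _ _ _ Hc') as [Ht [E|E]].
  + apply (Hb1 t); auto; [lra|]; intros u w B'.
    now apply (plate_contact_velocity1 g f x y t u w).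
  + apply (Hb2 t); auto; [lra|]; intros u w B'.
    now apply (plate_contact_velocity2 g f x y t u w).
Qed.

Lemma rising_and_low_motion (g m P t0 : R) (f : R -> R) :
  0 < g -> 0 < m -> 0 < P -> smooth f -> periodic P f -> Derive f t0 = P * g / 2 ->
  exists (z1 z2 : R -> R) (V1 V2 : nat -> R),
    two_ball_motion g m m f z1 z2 /\
    ball_velocities z1 z2 V1 /\
    plate_velocities f z2 V2 /\
    LimSup_seq (fun i => Rabs (V1 i)) = p_infty /\
    LimSup_seq (fun i => Rabs (V2 i)) = p_infty /\
    Rbar_lt (Rbar_max (LimInf_seq (fun i => Rabs (V1 i)))
                      (LimInf_seq (fun i => Rabs (V2 i)))) p_infty.
Proof.
intros Hg Hm HP Hs Hper H0.
destruct (smooth_periodic_lipschitz P f HP Hs Hper) as [M Hlip].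
destruct (smooth_periodic_critical_point P f HP Hs Hper) as [t1 H1].
assert (HgP : 0 < g * P) by now apply Rmult_lt_0_compat.
assert (HgPP : 0 < g * P * P) by now apply Rmult_lt_0_compat.
destruct (INR_unbounded (Rmax 0 (4 * M / (g * P)))) as [L HL].
assert (HL0 : 0 < INR L) by (generalize (Rmax_l 0 (4 * M / (g * P))); lra).
assert (HLM : 4 * M < g * P * INR L).
{ rewrite (Rmult_comm (g * P)); apply Rlt_div_l; [exact HgP|].
  generalize (Rmax_r 0 (4 * M / (g * P))); lra. }
(* [N] makes the lowest flight of the rising ball peak above the low ball. *)
destruct (INR_unbounded (8 * (f t1 - f t0) / (g * P * P))) as [N1 HN1].
set (N := (L + N1)%nat).
assert (HN : INR N = INR L + INR N1) by (unfold N; apply plus_INR).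
assert (HN1' := pos_INR N1).
assert (HL1 : 1 <= INR L).
{ assert (HL1 : (0 < L)%nat) by (apply INR_lt; simpl; lra). apply (le_INR 1) in HL1; exact HL1. }
destruct (time_in_the_past P t0 (- (P * INR (N * (N + 1)))) HP) as [n0 Hn0].
destruct (time_in_the_past P t1 0 HP) as [n1 Hn1].
set (c := t0 + P * IZR n0) in *; set (d := t1 + P * IZR n1) in *.
assert (Hc : Derive f c = P * g / 2).
{ unfold c; rewrite periodic_Z; [exact H0|now apply periodic_Derive]. }
assert (Hd : Derive f d = 0).
{ unfold d; rewrite periodic_Z; [exact H1|now apply periodic_Derive]. }
assert (Hfc : f c = f t0) by now apply periodic_Z.
assert (Hfd : f d = f t1) by now apply periodic_Z.
destruct (resonant_ball_exists g M P c f N 1) as [x Hx]; auto; [nra|lra|].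
destruct (level_ball_exists g M P d f (fun k => L * k)%nat) as [y Hy]; auto.
{ rewrite Nat.mul_0_r; simpl; lra. }
{ intros k; apply INR_lt; rewrite !mult_INR, S_INR; lra. }
{ intros k; rewrite !mult_INR, S_INR; lra. }
{ intros k; rewrite !mult_INR, !S_INR, Hd; field. }
assert (Hlow : forall k, d + P * INR (L * S k) - (d + P * INR (L * k)) = P * INR L).
{ intros k; rewrite !mult_INR, S_INR; ring. }
assert (Hp : generic_pair g f x y).
{ apply (level_balls_generic _ _ _ _ _ _ _ _ Hg Hx Hy).
  - (* The plate has different velocities at the bounces of the two balls. *)
    intros i j E.
    assert (E' : Derive f (resonant_time c P N 1 i) = Derive f (d + P * INR (L * j))) by now rewrite E.
    unfold resonant_time in E'.
    rewrite !(periodic_nat P (Derive f)), Hc, Hd in E' by now apply periodic_Derive.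
    lra.
  - intros i j; rewrite resonant_gap, Hlow, Hfc, Hfd; apply Rgt_not_eq.
    set (A := INR (2 * (N + i) + 1 + 1)).
    assert (HA : 2 * INR N <= A).
    { unfold A; rewrite !plus_INR, mult_INR, plus_INR; generalize (pos_INR i); simpl; lra. }
    assert (HA2 : INR N1 <= A ^ 2 - INR L ^ 2) by nra.
    assert (8 * (f t1 - f t0) < INR N1 * (g * P * P)) by (apply Rlt_div_l; assumption).
    assert (INR N1 * (g * P * P) <= (A ^ 2 - INR L ^ 2) * (g * P * P))
      by (apply Rmult_le_compat_r; lra).
    lra. }
destruct (generic_pair_motion g m f x y Hm Hp) as [Hmot [[V1 HV1] [V2 HV2]]].
assert (Hrise := fun B => resonant_gap_unbounded c P N 1 B HP).
exists (upper x y), (lower x y), V1, V2.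
split; [exact Hmot|split; [exact HV1|split; [exact HV2|split; [|split]]]].
- apply event_velocities_limsup_infty with (1 := HV1).
  apply (fast_ball_contact Hg Hp Hx Hy Hlow Hrise).
- apply event_velocities_limsup_infty with (1 := HV2).
  apply (fast_plate_contact Hg Hp Hx Hrise).
- unfold Rbar_max; destruct Rbar_le_dec.
  + apply event_velocities_liminf_finite with (1 := HV2) (M := g * (P * INR L) / 2).
    apply (slow_plate_contact Hg Hp Hy Hlow).
  + apply event_velocities_liminf_finite with (1 := HV1) (M := g * (P * INR L) / 2).
    apply (slow_ball_contact Hg Hp Hx Hy Hlow Hrise).
Qed.

Theorem theorem3 (g T m1 m2 : R) (f : R -> R) :
  0 < g -> 0 < T -> 0 < m1 -> 0 < m2 ->
  m1 = m2 ->
  smooth f ->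
  class_C g T f ->
  (exists (z1 z2 : R -> R) (V1 V2 : nat -> R),
      two_ball_motion g m1 m2 f z1 z2 /\
      ball_velocities z1 z2 V1 /\
      plate_velocities f z2 V2 /\
      is_lim_seq (fun i => Rabs (V1 i)) p_infty /\
      is_lim_seq (fun i => Rabs (V2 i)) p_infty)
  /\
  (exists (z1 z2 : R -> R) (V1 V2 : nat -> R),
      two_ball_motion g m1 m2 f z1 z2 /\
      ball_velocities z1 z2 V1 /\
      plate_velocities f z2 V2 /\
      LimSup_seq (fun i => Rabs (V1 i)) = p_infty /\
      LimSup_seq (fun i => Rabs (V2 i)) = p_infty /\
      Rbar_lt (Rbar_max (LimInf_seq (fun i => Rabs (V1 i)))
                        (LimInf_seq (fun i => Rabs (V2 i)))) p_infty).
Proof.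
intros Hg HT Hm _ <- Hs [Hper [t0 [K [HK H0]]]].
(* With respect to the period [K T] the plate velocity is the one with [K = 1]. *)
assert (HP : 0 < T * INR K) by now apply Rmult_lt_0_compat, lt_0_INR.
assert (HperP : periodic (T * INR K) f) by (intros t; now apply periodic_nat).
assert (H0P : Derive f t0 = T * INR K * g / 2) by (rewrite H0; field).
split.
- now apply (resonant_motion g m1 (T * INR K) t0).
- now apply (rising_and_low_motion g m1 (T * INR K) t0).
Qed.
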